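(* Let $A:\mathbb R\to\mathbb R^{n\times n}$ be continuous with $\sup_{t\in\mathbb R}\|A(t)\|=\mu<\infty$. Let $f:\mathbb R\times\mathbb R^n\times\mathbb R^n\to\mathbb R^n$ be continuous in its first argument, with $f(t,0,0)=0$ for all $t\in\mathbb R$ and $\|f(t,y_1,w_1)-f(t,y_2,w_2)\|\le l(\|y_1-y_2\|+\|w_1-w_2\|)$ for all $t,y_1,y_2,w_1,w_2$. Let the linear system $x'=A(t)x$ have an exponential dichotomy on $\mathbb R$ with constants $K,\sigma>0$. Put $M=e^{\mu\theta}$, $m=e^{-\mu\theta}$ and assume $$ lM\theta\,[1+M(1+l\theta)e^{Ml\theta}]<m .$$ Then every solution of $y'(t)=A(t)y(t)+f(t,y(t),y(\beta(t)))$ has a unique continuation.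
   Context: $\|\cdot\|$ is the Euclidean norm on $\mathbb R^n$ and the induced operator norm for matrices. $(\theta_i)_{i\in\mathbb Z}$ is a strictly increasing real sequence with $|\theta_i|\to\infty$ as $|i|\to\infty$ and $\theta_{i+1}-\theta_i\le\theta$ for all $i$, where $\theta>0$; $\beta(t)=\theta_i$ for $\theta_i\le t<\theta_{i+1}$. Exponential dichotomy: for a fundamental matrix $X(t)$ of $x'=A(t)x$ there is a projection $P$ with $\|X(t)PX^{-1}(s)\|\le Ke^{-\sigma(t-s)}$ for $t\ge s$ and $\|X(t)(I-P)X^{-1}(s)\|\le Ke^{-\sigma(s-t)}$ for $t\le s$. Solutions: for $\theta_i\le t_0<\theta_{i+1}$ and $x_0\in\mathbb R^n$, a solution $x(t)=x(t,t_0,x_0)$ is a continuous function on $[\theta_i,\infty)$ with $x(t_0)=x_0$, differentiable except possibly at the points $\theta_j\ge\theta_i$ (where the right derivative exists), satisfying the equation on each interval $(\theta_j,\theta_{j+1})$, $j\ge i$, and with the right derivative at the points $\theta_j$, $j\ge i$. Every solution starting at some $\theta_i$ can be continued to $+\infty$. The theorem is the conclusion of a discussion of the uniqueness of the backward continuation of solutions, for which the terminology is as follows. A point $(t_0,x_0)$ with $\theta_i<t_0\le\theta_{i+1}$ is backward continued to $t=\theta_i$ if there exist $\bar x\in\mathbb R^n$ and a solution $x(t,\theta_i,\bar x)$ of $x'=A(t)x+f(t,x(t),\bar x)$ with $x(\theta_i)=\bar x$ and $x(t_0,\theta_i,\bar x)=x_0$; it is uniquely backward continued to $\theta_i$ if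 this continuation is unique. A solution $x(t,t_0,x_0)$ is backward continued to $a<t_0$ if there are $\bar x\in\mathbb R^n$ and a solution $x(t,a,\bar x)$ with $x(t_0,a,\bar x)=x_0$, and uniquely so if the continuation is unique. *)

(* Defs.v *)
From HB Require Import structures.
From mathcomp Require Import all_boot all_order all_algebra.
From mathcomp Require Import all_classical all_reals all_analysis.

Set Implicit Arguments.
Unset Strict Implicit.
Unset Printing Implicit Defensive.

Import Order.TTheory GRing.Theory Num.Theory.
Import numFieldNormedType.Exports.

Local Open Scope classical_set_scope.
Local Open Scope ring_scope.

(* The library norm `|x| on matrices is the max norm; it induces the same
   topology as enorm and opnorm, so continuity and derivatives below are the
   library ones, while all quantitative estimates use enorm and opnorm. *)
Definition enorm (R : realType) (n : nat) (x : 'cV[R]_n) : R :=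
  Num.sqrt (\sum_(i < n) x i 0 ^+ 2).

(* The set is nonempty and bounded, so the real supremum is the genuine one. *)
Definition opnorm (R : realType) (n : nat) (B : 'M[R]_n) : R :=
  sup [set enorm (B *m x) | x in [set x : 'cV[R]_n | enorm x <= 1]].

Definition fundamental_matrix (R : realType) (n : nat)
    (A X : R -> 'M[R]_n) : Prop :=
  forall t : R, X t \in unitmx /\ is_derive t 1 X (A t *m X t).

Definition exponential_dichotomy (R : realType) (n : nat)
    (A : R -> 'M[R]_n) (K sigma : R) : Prop :=
  exists (X : R -> 'M[R]_n) (P : 'M[R]_n),
    [/\ fundamental_matrix A X,
        P *m P = P,
        forall t s : R, s <= t ->
          opnorm (X t *m P *m invmx (X s)) <= K * expR (- sigma * (t - s))
      & forall t s : R, t <= s ->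
          opnorm (X t *m (1%:M - P) *m invmx (X s))
            <= K * expR (- sigma * (s - t))].

Definition right_derivative (R : realType) (n : nat)
    (x : R -> 'cV[R]_n) (t : R) (v : 'cV[R]_n) : Prop :=
  h^-1 *: (x (t + h) - x t) @[h --> 0^'+] --> v.

(* |theta_i| -> oo as |i| -> oo is spelled out since int has no filter at
   infinity. *)
Definition switching_sequence (R : realType) (tau : int -> R) (theta : R)
    : Prop :=
  [/\ forall i j : int, i < j -> tau i < tau j,
      forall B : R, exists N : int, forall i : int, N <= `|i| -> B <= `|tau i|
    & forall i : int, tau (i + 1) - tau i <= theta].

Definition switching_argument (R : realType) (tau : int -> R) (beta : R -> R)
    : Prop :=
  forall (i : int) (t : R), tau i <= t -> t < tau (i + 1) -> beta t = tau i.

(* x is a solution x(t, t0, x0) of x'(t) = A(t) x(t) + f(t, x(t), x(beta(t))).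
   Its domain is [tau i, +oo[ with tau i <= t0 < tau (i + 1); the values of the
   total function x to the left of tau i are irrelevant. *)
Definition solution (R : realType) (n : nat) (A : R -> 'M[R]_n)
    (f : R -> 'cV[R]_n -> 'cV[R]_n -> 'cV[R]_n)
    (tau : int -> R) (beta : R -> R)
    (t0 : R) (x0 : 'cV[R]_n) (x : R -> 'cV[R]_n) : Prop :=
  exists i : int,
    [/\ tau i <= t0 < tau (i + 1),
        x t0 = x0,
        {within `[tau i, +oo[, continuous x},
        forall (j : int) (t : R), i <= j -> tau j < t < tau (j + 1) ->
          is_derive t 1 x (A t *m x t + f t (x t) (x (beta t)))
      & forall j : int, i <= j ->
          right_derivative x (tau j)
            (A (tau j) *m x (tau j)
             + f (tau j) (x (tau j)) (x (beta (tau j))))].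

Definition backward_continuation (R : realType) (n : nat) (A : R -> 'M[R]_n)
    (f : R -> 'cV[R]_n -> 'cV[R]_n -> 'cV[R]_n)
    (tau : int -> R) (beta : R -> R)
    (t0 : R) (x0 : 'cV[R]_n) (a : R)
    (xbar : 'cV[R]_n) (z : R -> 'cV[R]_n) : Prop :=
  solution A f tau beta a xbar z /\ z t0 = x0.

(* Two continuations are identified when they agree on their common domain,
   which is [beta a, +oo[. *)
Definition uniquely_backward_continued (R : realType) (n : nat)
    (A : R -> 'M[R]_n) (f : R -> 'cV[R]_n -> 'cV[R]_n -> 'cV[R]_n)
    (tau : int -> R) (beta : R -> R)
    (t0 : R) (x0 : 'cV[R]_n) (a : R) : Prop :=
  exists (xbar : 'cV[R]_n) (z : R -> 'cV[R]_n),
    backward_continuation A f tau beta t0 x0 a xbar z /\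
    forall (xbar' : 'cV[R]_n) (z' : R -> 'cV[R]_n),
      backward_continuation A f tau beta t0 x0 a xbar' z' ->
      xbar' = xbar /\ forall t : R, beta a <= t -> z' t = z t.

(* Main.v *)
(** On one interval [[tau k, tau (k + 1)]] a solution through [(c, x0)] is a
    fixed point of [z |-> x0 + \int_c^t g(s, z(s), z(tau k)) ds] with
    [g(t, y, w) = A(t) y + f(t, y, w)].  In the sup norm weighted by
    [W(t) = exp(mu |t - c|)] this map is a contraction with ratio
    [q = 1 - m + 2 l M theta]: the linear part contributes
    [\int_c^t mu W = W(t) - 1], the two Lipschitz terms of [f] at most
    [2 l M theta], and [W(t) <= M = 1/m].  Since [M (1 + l theta) e^(M l theta)]
    is at least [1], the smallness assumption yields [2 l M theta < m], that is
    [q < 1].  Hence exactly one solution on the closed interval passes through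
    any given point of it, whether [c] is the left end point (forward
    continuation) or any other point (backward continuation), and solutions on
    consecutive intervals are glued at the points [tau k]. *)
Require Import Defs.
From HB Require Import structures.
From mathcomp Require Import all_boot all_order all_algebra.
From mathcomp Require Import all_classical all_reals all_analysis.
From mathcomp Require Import ring lra zify.

Import Order.TTheory GRing.Theory Num.Theory.
Import numFieldNormedType.Exports.

Local Open Scope classical_set_scope.
Local Open Scope ring_scope.

(** * Euclidean norm, operator norm and a mean value inequality *)

Section EuclideanNorm.
Context {R : realType} {n : nat}.
Implicit Types x y : 'cV[R]_n.

Lemma enorm_sqr x : enorm x ^+ 2 = \sum_i x i 0 ^+ 2.
Proof. by rewrite sqr_sqrtr// sumr_ge0// => i _; rewrite sqr_ge0. Qed.

Lemma enorm_ge0 x : 0 <= enorm x.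
Proof. exact: sqrtr_ge0. Qed.

Lemma enorm0 : enorm (0 : 'cV[R]_n) = 0.
Proof.
by rewrite /enorm big1 ?sqrtr0// => i _; rewrite mxE expr0n.
Qed.

Lemma enormZ (k : R) x : enorm (k *: x) = `|k| * enorm x.
Proof.
rewrite /enorm -sqrtr_sqr -sqrtrM ?sqr_ge0// mulr_sumr.
by congr Num.sqrt; apply: eq_bigr => i _; rewrite mxE exprMn.
Qed.

Lemma enormN x : enorm (- x) = enorm x.
Proof. by rewrite -scaleN1r enormZ normrN1 mul1r. Qed.

Lemma enormBC x y : enorm (x - y) = enorm (y - x).
Proof. by rewrite -enormN opprB. Qed.

Lemma coord_le_enorm x i : `|x i 0| <= enorm x.
Proof.
rewrite -[leLHS]sqrtr_sqr ler_wsqrtr// (bigD1 i)//= lerDl.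
by rewrite sumr_ge0// => j _; rewrite sqr_ge0.
Qed.

Lemma enorm_eq0 x : enorm x = 0 -> x = 0.
Proof.
move=> x0; apply/colP => i; rewrite mxE; apply/normr0_eq0/eqP.
by rewrite eq_le normr_ge0 -x0 coord_le_enorm.
Qed.

Lemma enorm_le0_eq x y : enorm (x - y) <= 0 -> x = y.
Proof.
move=> xy; apply/eqP; rewrite -subr_eq0; apply/eqP/enorm_eq0/eqP.
by rewrite eq_le xy enorm_ge0.
Qed.

Lemma enorm_le_sum x : enorm x <= \sum_i `|x i 0|.
Proof.
have s0 : 0 <= \sum_i `|x i 0| by exact: sumr_ge0.
rewrite -[leRHS]ger0_norm// -sqrtr_sqr; apply: ler_wsqrtr.
rewrite expr2 mulr_sumr; apply: ler_sum => i _.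
rewrite -real_normK ?num_real// expr2 ler_wpM2r//.
by rewrite (bigD1 i)//= lerDl sumr_ge0.
Qed.

(** For nonzero vectors of norms [a] and [b], the nonnegative sum of the squares of [b x_i - a y_i]
    equals [2ab (ab - <x, y>)]. *)
Lemma cauchy_schwarz x y : \sum_i x i 0 * y i 0 <= enorm x * enorm y.
Proof.
have [->|x0] := eqVneq x 0.
  by rewrite enorm0 mul0r big1// => i _; rewrite mxE mul0r.
have [->|y0] := eqVneq y 0.
  by rewrite enorm0 mulr0 big1// => i _; rewrite mxE mulr0.
have pos (z : 'cV[R]_n) : z != 0 -> 0 < enorm z.
  move=> z0; rewrite lt_neqAle enorm_ge0 andbT eq_sym.
  by apply: contra_neq z0 => /enorm_eq0.
have {pos} := (pos _ x0, pos _ y0).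
set a := enorm x; set b := enorm y => -[a0 b0].
have : 0 <= \sum_i (b * x i 0 - a * y i 0) ^+ 2.
  by apply: sumr_ge0 => i _; rewrite sqr_ge0.
have -> : \sum_i (b * x i 0 - a * y i 0) ^+ 2 =
    b ^+ 2 * \sum_i x i 0 ^+ 2 - 2 * a * b * \sum_i x i 0 * y i 0
    + a ^+ 2 * \sum_i y i 0 ^+ 2.
  rewrite !mulr_sumr -sumrB -big_split/=; apply: eq_bigr => i _; ring.
rewrite -!enorm_sqr -/a -/b => h.
by rewrite -(ler_pM2l (mulr_gt0 a0 b0)); lra.
Qed.

Lemma enormD x y : enorm (x + y) <= enorm x + enorm y.
Proof.
rewrite -(@ler_pXn2r _ 2)// ?nnegrE ?addr_ge0 ?enorm_ge0// sqrrD !enorm_sqr.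
have -> : \sum_i (x + y) i 0 ^+ 2 =
    \sum_i x i 0 ^+ 2 + (\sum_i x i 0 * y i 0) *+ 2 + \sum_i y i 0 ^+ 2.
  rewrite -sumrMnl -!big_split/=; apply: eq_bigr => i _.
  by rewrite mxE sqrrD.
by rewrite lerD2r lerD2l lerMn2r cauchy_schwarz.
Qed.

Lemma enorm_dist x y z : enorm (x - y) <= enorm (x - z) + enorm (z - y).
Proof. by rewrite -(subrKA z) enormD. Qed.

Lemma enorm_dist_dist x y : `|enorm x - enorm y| <= enorm (x - y).
Proof.
have xy := enormD (x - y) y; have yx := enormD (y - x) x.
by rewrite !subrK in xy yx; rewrite ler_norml enormBC in yx *; apply/andP; lra.
Qed.

Lemma normr_le_enorm x : `|x| <= enorm x.
Proof.
rewrite [leLHS]/Num.Def.normr/= mx_normrE bigmax_le ?enorm_ge0//= => -[i j] _.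
by rewrite ord1 coord_le_enorm.
Qed.

Lemma enorm_le_normr x : enorm x <= n%:R * `|x|.
Proof.
apply: (le_trans (enorm_le_sum x)).
rewrite mulr_natl -[X in _ *+ X]card_ord -sumr_const.
apply: ler_sum => i _; rewrite [leRHS]/Num.Def.normr/= mx_normrE.
exact: (le_bigmax _ (fun ij => `|x ij.1 ij.2|) (i, 0)).
Qed.

Lemma enorm_mulmx_le (B : 'M[R]_n) x :
  enorm (B *m x) <= (\sum_i \sum_j `|B i j|) * enorm x.
Proof.
apply: (le_trans (enorm_le_sum _)).
rewrite mulr_suml; apply: ler_sum => i _; rewrite mxE mulr_suml.
apply: (le_trans (ler_norm_sum _ _ _)); apply: ler_sum => j _.
by rewrite normrM ler_wpM2l// coord_le_enorm.
Qed.

Lemma opnorm_set_bounded (B : 'M[R]_n) :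
  has_sup [set enorm (B *m x) | x in [set x : 'cV[R]_n | enorm x <= 1]].
Proof.
split; first by exists (enorm (B *m 0)), 0 => //=; rewrite enorm0.
exists (\sum_i \sum_j `|B i j|) => _ [x /= x1 <-].
apply: (le_trans (enorm_mulmx_le _ _)); rewrite ler_piMr//.
by apply: sumr_ge0 => i _; apply: sumr_ge0.
Qed.

Lemma opnorm_ge0 (B : 'M[R]_n) : 0 <= opnorm B.
Proof.
apply: ub_le_sup; first by case: (opnorm_set_bounded B).
by exists 0 => /=; rewrite ?mulmx0 enorm0.
Qed.

Lemma enorm_mulmx (B : 'M[R]_n) x : enorm (B *m x) <= opnorm B * enorm x.
Proof.
have [->|x0] := eqVneq x 0; first by rewrite mulmx0 enorm0 mulr0.
have e0 : 0 < enorm x.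
  rewrite lt_neqAle enorm_ge0 andbT eq_sym.
  by apply: contra_neq x0 => /enorm_eq0.
rewrite -ler_pdivrMr// mulrC -[X in X * _]gtr0_norm ?invr_gt0//.
rewrite -enormZ scalemxAr; apply: ub_le_sup.
  by case: (opnorm_set_bounded B).
by exists ((enorm x)^-1 *: x) => //=; rewrite enormZ gtr0_norm ?invr_gt0//
  mulVf ?gt_eqF.
Qed.

(** The max norm and the Euclidean norm differ by at most a factor [n], so limits in the library
    topology can be tested with Euclidean estimates. *)
Lemma cvg_enormP {T : Type} {F : set_system T} {FF : Filter F}
    (f : T -> 'cV[R]_n) (v : 'cV[R]_n) :
  f @ F --> v <-> forall e, 0 < e -> \forall t \near F, enorm (v - f t) <= e.
Proof.
split=> [/cvgrPdist_le fv e e0|fv].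
  (* Dividing by [n + 1] instead of [n] covers dimension 0. *)
  have e' : 0 < e / n.+1%:R by rewrite divr_gt0.
  apply: filterS (fv _ e') => t ft; apply: (le_trans (enorm_le_normr _)).
  apply: (@le_trans _ _ (n.+1%:R * (e / n.+1%:R))).
    by rewrite ler_pM// ler_nat.
  by rewrite mulrCA mulfV// mulr1.
apply/cvgrPdist_le => e /fv; apply: filterS => t.
exact/le_trans/normr_le_enorm.
Qed.

Lemma cvg_enorm {T : Type} {F : set_system T} {FF : Filter F}
    (f : T -> 'cV[R]_n) (v : 'cV[R]_n) :
  f @ F --> v -> enorm (f t) @[t --> F] --> enorm v.
Proof.
move=> /cvg_enormP fv; apply/cvgrPdist_le => e /fv; apply: filterS => t.
exact/le_trans/enorm_dist_dist.
Qed.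

Lemma is_derive_col (f : R -> 'cV[R]_n) (t : R) (v : 'cV[R]_n) :
  is_derive t 1 f v <-> forall i, is_derive t 1 (fun s => f s i 0) (v i 0).
Proof.
split=> [[df <-] i|df].
  split; first by have /derivable_mxP := df; exact.
  by rewrite derive_mx// mxE.
have drv : derivable f t 1.
  by apply/derivable_mxP => i j; rewrite ord1; case: (df i).
split=> //; rewrite derive_mx//; apply/colP => i; rewrite mxE.
by case: (df i).
Qed.

(** Reduction to the scalar mean value theorem: with [e = h b - h a], the function
    [p = |e| u - <e, h>] has nonnegative derivative by Cauchy-Schwarz, and its increment is
    [|e| (u b - u a) - |e|^2]; dividing by [|e|] gives the bound. *)
Lemma enorm_increment_le (a b : R) (h dh : R -> 'cV[R]_n) (u du : R -> R) :
  a <= b -> {within `[a, b], continuous h} -> {within `[a, b], continuous u} ->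
  (forall t, t \in `]a, b[ -> is_derive t 1 h (dh t)) ->
  (forall t, t \in `]a, b[ -> is_derive t 1 u (du t)) ->
  (forall t, t \in `]a, b[ -> enorm (dh t) <= du t) ->
  enorm (h b - h a) <= u b - u a.
Proof.
rewrite le_eqVlt => /predU1P[->|ab] ch cu dhE duE hu.
  by rewrite !subrr enorm0.
set e := h b - h a.
pose p t := enorm e * u t - \sum_i e i 0 * h t i 0.
have [c cab] : exists2 c, c \in `]a, b[ &
    p b - p a = (enorm e * du c - \sum_i e i 0 * dh c i 0) * (b - a).
  apply: (@MVT R p (fun t => enorm e * du t - \sum_i e i 0 * dh t i 0)) => //.
    move=> t tab; rewrite /p.
    apply: (@is_deriveB _ _ _ (fun t => enorm e * u t)).
      by have := duE _ tab => ?; apply: is_deriveZ.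
    have -> : (fun t => \sum_i e i 0 * h t i 0) = \sum_i (fun t => e i 0 * h t
      i 0).
      by apply/funext => s; rewrite fct_sumE.
    apply: is_derive_sum => i.
    have := (is_derive_col _ _ _).1 (dhE _ tab) i => ?; exact: is_deriveZ.
  move=> t; apply: cvgB; first by apply: cvgM; [exact: cvg_cst|exact: cu].
  apply: cvg_big => [|i _]; first exact: add_continuous.
  apply: cvgM; first exact: cvg_cst.
  by have := continuous_comp (ch t) (@coord_continuous _ _ _ i 0 _).
have dp : 0 <= enorm e * du c - \sum_i e i 0 * dh c i 0.
  rewrite subr_ge0; apply: (le_trans (cauchy_schwarz _ _)).
  by rewrite ler_wpM2l ?enorm_ge0// hu.
(* When [e = 0] this division is impossible, but then only [u a <= u b] is needed, which follows
   from [0 <= |dh| <= du]. *)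
have [e0 _|e0] := eqVneq (enorm e) 0; last first.
  move=> pE; have : 0 <= p b - p a by rewrite pE mulr_ge0// subr_ge0 ltW.
  have -> : p b - p a = enorm e * (u b - u a) - enorm e * enorm e.
    have eE : \sum_i e i 0 ^+ 2 = \sum_i e i 0 * h b i 0 - \sum_i e i 0 * h a i
      0.
      rewrite -sumrB; apply: eq_bigr => i _.
      by rewrite -mulrBr expr2; congr (_ * _); rewrite !mxE.
    by rewrite -expr2 enorm_sqr eE /p; ring.
  rewrite -mulrBr pmulr_rge0 ?subr_ge0//.
  by rewrite lt_neqAle eq_sym e0 enorm_ge0.
rewrite e0; have [d dab ->] := MVT ab duE cu.
by rewrite mulr_ge0 ?(le_trans (enorm_ge0 _) (hu _ dab))// subr_ge0 ltW.
Qed.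

End EuclideanNorm.

(** * Antiderivatives of continuous functions *)

Section Antiderivative.
Context {R : realType}.

(** Integration starts at [a - 1], so the derivative is two-sided even at the end points [a] and
    [b]. *)
Lemma antiderivative (h : R -> R) (a b : R) : continuous h ->
  exists H : R -> R, forall t, t \in `[a, b] -> is_derive t 1 H (h t).
Proof.
move=> ch; exists (fun x => (\int[lebesgue_measure]_(t in `[a - 1, x]) h t)%R)
  => t.
rewrite in_itv/= => /andP[ta tb].
have [] := @continuous_FTC1_closed R h (a - 1) t (b + 1).
- lra.
- apply: continuous_compact_integrable; first exact: segment_compact.
  exact: continuous_subspaceT.
- lra.
- exact: ch.
- by move=> dH HE; apply: DeriveDef; [exact: dH|rewrite -derive1E HE].
Qed.

Lemma antiderivative_col {n : nat} (h : R -> 'cV[R]_n) (a b : R) :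
  continuous h -> forall (c : R) (x0 : 'cV[R]_n),
  exists H : R -> 'cV[R]_n,
    H c = x0 /\ forall t, t \in `[a, b] -> is_derive t 1 H (h t).
Proof.
move=> ch c x0.
have /choice[H HE] i : exists H : R -> R,
    forall t, t \in `[a, b] -> is_derive t 1 H (h t i 0).
  apply: antiderivative => t.
  exact: continuous_comp (ch t) (@coord_continuous _ _ _ i 0 _).
exists (fun t => x0 + \col_i (H i t - H i c)); split.
  by apply/colP => i; rewrite !mxE subrr addr0.
move=> t tab; apply/is_derive_col => i; have Hi := HE i t tab.
have -> : (fun s => (x0 + \col_i (H i s - H i c)) i 0) =
    H i + cst (x0 i 0 - H i c).
  by apply/funext => s; rewrite !mxE/= !fctE; ring.
by rewrite -[h t i 0]addr0; apply: is_deriveD.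
Qed.

End Antiderivative.

(** * Uniform limits of geometrically converging sequences *)

Section UniformLimit.
Context {R : realType} {n : nat}.

Lemma uniform_geometric_limit (q C : R) (Z : nat -> R -> 'cV[R]_n) :
  0 <= q < 1 -> (forall k t, enorm (Z k.+1 t - Z k t) <= C * q ^+ k) ->
  exists2 D, 0 <= D &
  exists Zoo : R -> 'cV[R]_n, forall k t, enorm (Zoo t - Z k t) <= D * q ^+ k.
Proof.
move=> /andP[q0 q1] dZ; pose D := C / (1 - q).
have C0 : 0 <= C by have := dZ 0 0; rewrite expr0 mulr1;
  apply/le_trans/enorm_ge0.
have D0 : 0 <= D by rewrite divr_ge0// subr_ge0 ltW.
(* [D] is the sum of the geometric series, so that [C q^k = D q^k - D q^(k+1)] telescopes. *)
have CE : C = D - D * q by rewrite /D; field; rewrite subr_eq0 gt_eqF.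
(* The sequences [Z k t i - D q^k] and [Z k t i + D q^k] are respectively
   nondecreasing and nonincreasing, so the sup of the former is the limit. *)
have near_k k t i : `|Z k.+1 t i 0 - Z k t i 0| <= D * q ^+ k - D * q ^+ k.+1.
  have := le_trans (coord_le_enorm (Z k.+1 t - Z k t) i) (dZ k t).
  by rewrite !mxE CE exprS mulrBl mulrA.
have upper t i : nonincreasing_seq (fun k => Z k t i 0 + D * q ^+ k).
  apply/nonincreasing_seqP => k; have := near_k k t i.
  by rewrite ler_norml => /andP[]; lra.
have lower t i : nondecreasing_seq (fun k => Z k t i 0 - D * q ^+ k).
  apply/nondecreasing_seqP => k; have := near_k k t i.
  by rewrite ler_norml => /andP[]; lra.
have cross t i j k : Z j t i 0 - D * q ^+ j <= Z k t i 0 + D * q ^+ k.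
  have pos m : 0 <= D * q ^+ m by rewrite mulr_ge0// exprn_ge0.
  apply: (le_trans (lower t i _ _ (leq_maxl j k))).
  by apply: le_trans (upper t i _ _ (leq_maxr j k)); have := pos (maxn j k);
    lra.
pose l t i := sup (range (fun k => Z k t i 0 - D * q ^+ k)).
have l_le t i k : l t i <= Z k t i 0 + D * q ^+ k.
  by apply: ge_sup => [|_ [j _ <-]]; [exists (Z 0 t i 0 - D * q ^+ 0), 0|exact:
    cross].
have l_ge t i k : Z k t i 0 - D * q ^+ k <= l t i.
  apply: ub_le_sup; last by exists k.
  by exists (Z 0 t i 0 + D * q ^+ 0) => _ [j _ <-].
exists (n%:R * D); first by rewrite mulr_ge0.
exists (fun t => \col_i l t i) => k t; apply: (le_trans (enorm_le_sum _)).
rewrite -mulrA [leRHS]mulr_natl -[X in _ *+ X]card_ord -sumr_const.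
apply: ler_sum => i _; rewrite !mxE ler_norml.
by have := l_le t i k; have := l_ge t i k; lra.
Qed.

(** A three-epsilon argument through [Z k t] and [Z k s], with [k] chosen independently of the
    points. *)
Lemma uniform_geometric_limit_continuous (q D : R) (Z : nat -> R -> 'cV[R]_n)
    (Zoo : R -> 'cV[R]_n) :
  0 <= q < 1 -> (forall k, continuous (Z k)) ->
  (forall k t, enorm (Zoo t - Z k t) <= D * q ^+ k) -> continuous Zoo.
Proof.
move=> /andP[q0 q1] cZ ZooE t; apply/cvg_enormP => e e0.
have [k kE] : exists k, D * q ^+ k <= e / 3.
  have q1' : `|q| < 1 by rewrite ger0_norm.
  have /cvgrPdist_le/(_ (e / 3)) := cvg_geometric D q1'.
  rewrite divr_gt0// => /(_ isT)[k _ kE]; exists k.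
  have := kE k (leqnn k); rewrite /geometric/= sub0r normrN;
    apply/le_trans/ler_norm.
have /cvg_enormP/(_ (e / 3)) := cZ k t.
rewrite divr_gt0// => /(_ isT); apply: filterS => s ts.
have := enorm_dist (Zoo t) (Zoo s) (Z k t).
have := enorm_dist (Z k t) (Zoo s) (Z k s).
have := ZooE k t; have := ZooE k s; rewrite enormBC; lra.
Qed.

End UniformLimit.

(** * Growth estimates with the exponential weight *)

Section Contraction.
Context {R : realType} {n : nat}.

Lemma is_derive_expR_affine (p c s : R) :
  is_derive s 1 (fun t => expR (p * (t - c))) (p * expR (p * (s - c))).
Proof.
have d : is_derive s 1 (fun t => p * (t - c)) p.
  by apply: is_derive_eq; rewrite subr0 /GRing.scale/= mulr1.
have := @is_derive1_comp R expR (fun t => p * (t - c)) s _ _ (is_derive_expR _)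
  d.
by rewrite mulrC.
Qed.

Lemma is_derive_within (a b : R) (V : normedModType R) (f df : R -> V) :
  (forall t, t \in `[a, b] -> is_derive t 1 f (df t)) ->
  {within `[a, b], continuous f}.
Proof.
move=> fE; apply: continuous_in_subspaceT => t; rewrite inE/= => tab.
by apply/differentiable_continuous/derivable1_diffP; case: (fE t tab).
Qed.

(* [p = 1] and [p = -1] bound [h] to the right and to the left of [c]. *)
Lemma is_derive_exp_bound (mu k N p c s : R) : p * p = 1 ->
  is_derive s 1 (fun t => p * N * (expR (p * mu * (t - c)) + k * p * (t - c)))
    (N * (mu * expR (p * mu * (s - c)) + k)).
Proof.
move=> p1; have := is_derive_expR_affine (p * mu) c s => d.
have d' : is_derive s 1 (fun t => t - c) 1.
  by apply: is_derive_eq; rewrite subr0.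
have := is_deriveZ (p * N) (is_deriveD d (is_deriveZ (k * p) d')).
have -> : (p * N) \*: ((fun t => expR (p * mu * (t - c))) + (k * p) \*: (fun t
  => t - c))
    = (fun t => p * N * (expR (p * mu * (t - c)) + k * p * (t - c))).
  by [].
move=> D; apply: (is_derive_eq D).
rewrite /GRing.scale/=.
have -> : p * N * (p * mu * expR (p * mu * (s - c)) + k * p * 1) =
  (p * p) * (N * (mu * expR (p * mu * (s - c)) + k)) by ring.
by rewrite p1 mul1r.
Qed.

(** Integrated from [c], the bound on [dh] gives [N (exp(mu |t - c|) - 1 + k |t - c|)], and
    [|t - c| <= theta]. The weight may have a corner at [c], so the mean value inequality is applied
    on each side separately, with a smooth majorant for each sign [p]. *)
Lemma weighted_growth (mu theta k N a b c : R) (h dh : R -> 'cV[R]_n) :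
  0 <= k -> 0 <= N -> c \in `[a, b] -> b - a <= theta ->
  {within `[a, b], continuous h} -> h c = 0 ->
  (forall t, t \in `]a, b[ -> is_derive t 1 h (dh t)) ->
  (forall t, t \in `]a, b[ ->
     enorm (dh t) <= N * (mu * expR (mu * `|t - c|) + k)) ->
  forall t, t \in `[a, b] ->
    enorm (h t) <= N * (expR (mu * `|t - c|) - 1 + k * theta).
Proof.
move=> k0 N0; rewrite in_itv/= => /andP[ac cb] ab ch hc dhE hb t.
rewrite in_itv/= => /andP[at_ tb].
have sub_oo x y s : a <= x -> y <= b -> s \in `]x, y[ -> s \in `]a, b[.
  rewrite !in_itv/= => ax yb /andP[xs sy].
  by rewrite (le_lt_trans ax xs) (lt_le_trans sy yb).
have sub_cc x y : a <= x -> y <= b -> {within `[x, y], continuous h}.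
  move=> ax yb; apply: continuous_subspaceW ch => s /=.
  by rewrite !in_itv/= => /andP[xs sy]; rewrite (le_trans ax xs) (le_trans sy
    yb).
pose u (p s : R) := p * N * (expR (p * mu * (s - c)) + k * p * (s - c)).
pose du (p s : R) := N * (mu * expR (p * mu * (s - c)) + k).
have duE (p s : R) : p * p = 1 -> is_derive s 1 (u p) (du p s).
  exact: is_derive_exp_bound.
have cu (p x y : R) : p * p = 1 -> {within `[x, y], continuous (u p)}.
  by move=> p1; exact: (is_derive_within _ _ _ (u p) (du p) (fun s _ => duE p s
    p1)).
have sign (p s : R) : p * (s - c) = `|s - c| -> p * mu * (s - c) = mu * `|s -
  c|.
  by move=> <-; ring.
have [ct|tc] := leP c t.
  have p1 : 1 * 1 = 1 :> R by rewrite mulr1.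
  have hb1 s : s \in `]c, t[ -> enorm (dh s) <= du 1 s.
    move=> sct; rewrite /du sign; first exact/hb/(sub_oo c t).
    by move: sct; rewrite in_itv/= => /andP[cs _];
      rewrite mul1r gtr0_norm ?subr_gt0.
  have := enorm_increment_le _ _ _ _ _ _ ct (sub_cc _ _ ac tb) (cu 1 _ _ p1)
    (fun s sct => dhE _ (sub_oo _ _ s ac tb sct)) (fun s _ => duE 1 s p1) hb1.
  rewrite hc subr0 /u subrr !mulr0 addr0 expR0 sign; last first.
    by rewrite mul1r ger0_norm ?subr_ge0.
  move/le_trans; apply.
  rewrite [leLHS](_ : _ = N * (expR (mu * `|t - c|) - 1 + k * (t - c)));
    last by ring.
  by apply: ler_wpM2l => //; rewrite lerD2l; apply: ler_wpM2l => //; lra.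
have N1 : -1 * -1 = 1 :> R by rewrite mulrNN mulr1.
have abs_lt s : s < c -> -1 * (s - c) = `|s - c|.
  by move=> sc; rewrite ltr0_norm ?subr_lt0// mulN1r.
have hb1 s : s \in `]t, c[ -> enorm (dh s) <= du (-1) s.
  move=> sct; rewrite /du sign; first exact/hb/(sub_oo t c).
  by move: sct; rewrite in_itv/= => /andP[_ /abs_lt].
have := enorm_increment_le _ _ _ _ _ _ (ltW tc) (sub_cc _ _ at_ cb) (cu (-1) _
  _ N1)
  (fun s sct => dhE _ (sub_oo _ _ s at_ cb sct)) (fun s _ => duE (-1) s N1) hb1.
rewrite hc sub0r enormN /u subrr !mulr0 addr0 expR0 sign ?abs_lt//.
move/le_trans; apply.
rewrite [leLHS](_ : _ = N * (expR (mu * `|t - c|) - 1 + k * (c - t)));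
  last by ring.
by apply: ler_wpM2l => //; rewrite lerD2l; apply: ler_wpM2l => //; lra.
Qed.

End Contraction.

(** * The Picard map on one interval *)

Section LocalProblem.
Context {R : realType} {n : nat} (g : R -> 'cV[R]_n -> 'cV[R]_n -> 'cV[R]_n)
  (mu l theta : R) (mu_ge0 : 0 <= mu) (l_ge0 : 0 <= l) (theta_ge0 : 0 <= theta)
  (g_cont : forall y w, continuous (fun t => g t y w))
  (g_lip : forall t y1 y2 w1 w2, enorm (g t y1 w1 - g t y2 w2)
     <= (mu + l) * enorm (y1 - y2) + l * enorm (w1 - w2))
  (small : 2 * l * expR (mu * theta) * theta < expR (- (mu * theta))).
Context (a b c : R) (cab : c \in `[a, b]) (abtheta : b - a <= theta).

Let k := 2 * l * expR (mu * theta).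
Let q := 1 - expR (- (mu * theta)) + k * theta.
Let W t := expR (mu * `|t - c|).

Let k_ge0 : 0 <= k.
Proof. by rewrite /k !mulr_ge0// expR_ge0. Qed.

Let q_lt1 : 0 <= q < 1.
Proof.
have m1 : expR (- (mu * theta)) <= 1.
  by rewrite -expR0 ler_expR oppr_le0 mulr_ge0.
have : 0 <= k * theta by rewrite mulr_ge0.
move=> kt; have kE : k * theta < expR (- (mu * theta)) by [].
by rewrite /q; apply/andP; split; lra.
Qed.

Let W_ge1 t : 1 <= W t.
Proof. by rewrite -expR0 ler_expR mulr_ge0. Qed.

Let W_le t : t \in `[a, b] -> W t <= expR (mu * theta).
Proof.
move: cab; rewrite !in_itv/= => /andP[ac cb] /andP[at_ tb].
by rewrite ler_expR ler_wpM2l// ler_norml; have := abtheta; lra.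
Qed.

Let a_ab : a \in `[a, b].
Proof.
move: cab; rewrite !in_itv/= => /andP[ac cb].
by rewrite lexx (le_trans ac cb).
Qed.

(** [y1] and [y2] are Picard images of [z1] and [z2], described by derivatives and a common value at
    [c] rather than by integrals; the estimate thus serves both iterates and genuine solutions, for
    which [y = z]. *)
Lemma picard_contraction (z1 z2 y1 y2 : R -> 'cV[R]_n) (N : R) :
  {within `[a, b], continuous y1} -> {within `[a, b], continuous y2} ->
  y1 c = y2 c ->
  (forall t, t \in `]a, b[ -> is_derive t 1 y1 (g t (z1 t) (z1 a))) ->
  (forall t, t \in `]a, b[ -> is_derive t 1 y2 (g t (z2 t) (z2 a))) ->
  (forall t, t \in `[a, b] -> enorm (z1 t - z2 t) <= N * W t) ->
  forall t, t \in `[a, b] -> enorm (y1 t - y2 t) <= q * N * W t.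
Proof.
move=> cy1 cy2 y12c dy1 dy2 z12 t tab.
have N0 : 0 <= N.
  have := le_trans (enorm_ge0 _) (z12 _ a_ab).
  by rewrite pmulr_lge0// expR_gt0.
have cy : {within `[a, b], continuous (y1 - y2)}.
  by move=> s; exact: cvgB (cy1 s) (cy2 s).
have yc : (y1 - y2) c = 0 by rewrite !fctE y12c subrr.
have dy s : s \in `]a, b[ ->
    is_derive s 1 (y1 - y2) (g s (z1 s) (z1 a) - g s (z2 s) (z2 a)).
  by move=> sab; exact: is_deriveB (dy1 s sab) (dy2 s sab).
have dyb s : s \in `]a, b[ ->
    enorm (g s (z1 s) (z1 a) - g s (z2 s) (z2 a)) <=
    N * (mu * expR (mu * `|s - c|) + k).
  move=> sab; have sab' : s \in `[a, b] by exact: subset_itv_oo_cc sab.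
  apply: (le_trans (g_lip _ _ _ _ _)).
  (* The difference at [s] keeps its weight [W s], while the one at [a], which may be far from [c],
     is bounded by the largest weight [exp(mu theta)]. *)
  apply: (@le_trans _ _ ((mu + l) * (N * W s) + l * (N * expR (mu * theta)))).
    apply: lerD; apply: ler_wpM2l => //; first by rewrite addr_ge0.
      exact: z12.
    apply: (le_trans (z12 _ a_ab)).
    by apply: ler_wpM2l => //; exact: W_le.
  rewrite -/(W s) [leLHS](_ : _ = N * (mu * W s + (l * W s + l * expR (mu *
    theta)))); last by ring.
  apply: ler_wpM2l => //; rewrite lerD2l.
  have := ler_wpM2l l_ge0 (W_le _ sab'); rewrite /k; lra.
have := weighted_growth mu theta k N a b c _ _ k_ge0 N0 cab abtheta cy yc dy
  dyb t tab.
rewrite -/(W t) => /le_trans; apply.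
rewrite (_ : q * N * W t = N * (q * W t)); last by ring.
apply: ler_wpM2l => //.
(* With [m = exp(- mu theta)], the inequalities [m W <= 1] and [1 <= W] turn [W - 1 + k theta] into
   at most [q W]. *)
have mW : expR (- (mu * theta)) * W t <= 1.
  by rewrite expRN mulrC ler_pdivrMr ?expR_gt0// mul1r W_le.
have kW : k * theta <= k * theta * W t.
  by rewrite -[leLHS]mulr1 ler_wpM2l// mulr_ge0.
rewrite /q; lra.
Qed.

Lemma continuous_on_bounded (y : R -> 'cV[R]_n) :
  {within `[a, b], continuous y} ->
  exists2 N, 0 <= N & forall t, t \in `[a, b] -> enorm (y t) <= N * W t.
Proof.
move=> cy.
have ab : a <= b by move: a_ab; rewrite in_itv/= lexx.
have [|s sab smax] := @EVT_max R (fun t => enorm (y t)) a b ab.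
  by move=> t; apply: cvg_enorm; exact: cy.
exists (enorm (y s)); first exact: enorm_ge0.
move=> t tab; apply: (le_trans (smax t tab)).
by rewrite -[leLHS]mulr1 ler_wpM2l// enorm_ge0.
Qed.

Let geometric_bound_eq0 (C x : R) : (forall j, x <= C * q ^+ j) -> x <= 0.
Proof.
have /andP[q0 q1] := q_lt1; move=> xC.
have q1' : `|q| < 1 by rewrite ger0_norm.
have gq := cvg_geometric C q1'.
by apply: (cvgr_to_ge gq); apply: nearW => j; exact: xC.
Qed.

(** Both solutions are their own Picard images, so a bound [N] on their weighted distance improves
    to [N q^j] for every [j]. *)
Lemma local_uniqueness (y1 y2 : R -> 'cV[R]_n) :
  {within `[a, b], continuous y1} -> {within `[a, b], continuous y2} ->
  y1 c = y2 c ->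
  (forall t, t \in `]a, b[ -> is_derive t 1 y1 (g t (y1 t) (y1 a))) ->
  (forall t, t \in `]a, b[ -> is_derive t 1 y2 (g t (y2 t) (y2 a))) ->
  forall t, t \in `[a, b] -> y1 t = y2 t.
Proof.
move=> cy1 cy2 y12c dy1 dy2 t tab.
have [|N N0 NE] := @continuous_on_bounded (y1 - y2).
  by move=> s; exact: cvgB (cy1 s) (cy2 s).
apply/enorm_le0_eq/(@geometric_bound_eq0 (N * W t)) => j.
suff : forall s, s \in `[a, b] -> enorm (y1 s - y2 s) <= N * q ^+ j * W s.
  by move/(_ t tab); rewrite mulrAC.
elim: j => [|j IH] s sab; first by rewrite expr0 mulr1; exact: NE.
have := picard_contraction y1 y2 y1 y2 _ cy1 cy2 y12c dy1 dy2 IH s sab.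
by rewrite exprS mulrCA.
Qed.

(** Continuity of [g] in [t] suffices along a continuous curve, because the Lipschitz bound absorbs
    the change of [z t]. *)
Let continuous_rhs (z : R -> 'cV[R]_n) (w : 'cV[R]_n) :
  continuous z -> continuous (fun t => g t (z t) w).
Proof.
move=> cz t; apply/cvg_enormP => e e0.
have ml0 : 0 < mu + l + 1 by rewrite ltr_pwDr// addr_ge0.
have e1 : 0 < e / 2 / (mu + l + 1) by rewrite !divr_gt0.
have e2 : 0 < e / 2 by rewrite divr_gt0.
have /cvg_enormP/(_ _ e1) zt := cz t.
have /cvg_enormP/(_ _ e2) gt := g_cont (z t) w t.
apply: filterS (filterI gt zt) => s [gs zs].
apply: (le_trans (enorm_dist _ _ (g s (z t) w))).
rewrite [leRHS]splitr; apply: lerD => //; apply: (le_trans (g_lip _ _ _ _ _)).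
rewrite subrr enorm0 mulr0 addr0.
apply: (@le_trans _ _ ((mu + l + 1) * (e / 2 / (mu + l + 1)))).
  by apply: ler_pM; rewrite ?addr_ge0 ?enorm_ge0 ?lerDl.
by rewrite mulrC divfK// gt_eqF.
Qed.

Lemma local_existence (x0 : 'cV[R]_n) :
  exists y : R -> 'cV[R]_n, y c = x0 /\
    forall t, t \in `[a, b] -> is_derive t 1 y (g t (y t) (y a)).
Proof.
have ab : a <= b by move: a_ab; rewrite in_itv/= lexx.
(* [r] retracts the line onto [[a, b]]. Composing with it makes the iterates continuous on the whole
   line, as the antiderivative requires, whatever [T z] does outside [[a, b]]. *)
pose r (t : R) := Num.max a (Num.min t b).
have r_ab t : r t \in `[a, b].
  by rewrite in_itv/= /r le_max lexx/= ge_max ab/= ge_min lexx orbT.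
have r_id t : t \in `[a, b] -> r t = t.
  rewrite in_itv/= => /andP[at_ tb]; rewrite /r.
  by rewrite (min_idPl tb) (max_idPr at_).
have cr : continuous r.
  move=> t; apply/cvgrPdist_le => e e0.
  have /cvgrPdist_le/(_ e e0) := @cvg_id _ (nbhs t).
  apply: filterS => s; apply: le_trans; rewrite /r.
  have := ler_norm (t - s); have := ler_norm (s - t);
    rewrite (distrC s t) ler_norml.
  by case: (leP s b) => ?; case: (leP t b) => ?; case: (leP a s) => ?;
    case: (leP a t) => ?; case: (leP a b) => ? *; apply/andP; split; lra.
(* [T] is the Picard map, by a choice of antiderivatives; nothing is asked of it at a discontinuous
   [z]. *)
have /choice[T TE] (z : R -> 'cV[R]_n) : exists y : R -> 'cV[R]_n,
    continuous z -> y c = x0 /\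
    forall t, t \in `[a, b] -> is_derive t 1 y (g t (z t) (z a)).
  have [cz|?] := pselect (continuous z); last by exists z.
  have [y yE] := antiderivative_col _ a b (continuous_rhs z (z a) cz) c x0.
  by exists y.
pose Z j := iter j (fun z => T z \o r) (cst x0).
have cTr (z : R -> 'cV[R]_n) : continuous z -> continuous (T z \o r).
  move=> cz t; apply: continuous_comp; first exact: cr.
  apply/differentiable_continuous/derivable1_diffP.
  by have [_ /(_ _ (r_ab t))[]] := TE z cz.
have cZ j : continuous (Z j) by elim: j => [t|j IH];
  [exact: cvg_cst|exact: cTr].
have Zr j t : Z j (r t) = Z j t.
  by case: j => [//|j]; rewrite /Z/= r_id.
have cT (z : R -> 'cV[R]_n) : continuous z -> {within `[a, b], continuous (T
  z)}.
  move=> cz; have [_ TzE] := TE z cz.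
  exact: (is_derive_within _ _ _ _ (fun t => g t (z t) (z a)) TzE).
have contr (z1 z2 : R -> 'cV[R]_n) N : continuous z1 -> continuous z2 ->
    (forall t, t \in `[a, b] -> enorm (z1 t - z2 t) <= N * W t) ->
    forall t, t \in `[a, b] -> enorm (T z1 t - T z2 t) <= q * N * W t.
  move=> cz1 cz2; have [T1c T1d] := TE z1 cz1; have [T2c T2d] := TE z2 cz2.
  exact: (picard_contraction z1 z2 (T z1) (T z2) N (cT z1 cz1) (cT z2 cz2)
    (etrans T1c (esym T2c)) (fun t tab => T1d t (subset_itv_oo_cc tab))
    (fun t tab => T2d t (subset_itv_oo_cc tab))).
have [N N0 NE] := @continuous_on_bounded (Z 1%N - Z 0%N)
  (continuous_subspaceT (fun t => cvgB (cZ 1%N t) (cZ 0%N t))).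
have dZ j t : enorm (Z j.+1 t - Z j t) <= N * expR (mu * theta) * q ^+ j.
  rewrite -Zr -(Zr j).
  suff H s : s \in `[a, b] -> enorm (Z j.+1 s - Z j s) <= N * q ^+ j * W s.
    apply: (le_trans (H _ (r_ab t))); rewrite [leRHS]mulrAC ler_wpM2l ?W_le//.
    by rewrite mulr_ge0// exprn_ge0//; case/andP: q_lt1.
  elim: j s => [|j IH] s sab; first by rewrite expr0 mulr1; exact: NE.
  rewrite exprS mulrCA /Z/= r_id//; apply: contr => //;
    [exact: (cZ j.+1)|exact: cZ].
have [D D0 [z zE]] := uniform_geometric_limit _ _ _ q_lt1 dZ.
have cz := uniform_geometric_limit_continuous _ _ _ _ q_lt1 cZ zE.
(* Compare with [Z j.+1], which is [T (Z j)] on [[a, b]]: the contraction bounds one distance by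
   [D W q^j], uniform convergence the other by [D q^j]. *)
have Tz t : t \in `[a, b] -> T z t = z t.
  move=> tab; apply/enorm_le0_eq/(@geometric_bound_eq0 (D * W t + D)) => j.
  apply: (le_trans (enorm_dist _ _ (Z j.+1 t))).
  have zj : forall s, s \in `[a, b] -> enorm (z s - Z j s) <= D * q ^+ j * W s.
    move=> s sab; apply: (le_trans (zE j s)).
    by rewrite ler_peMr// mulr_ge0// exprn_ge0//; case/andP: q_lt1.
  have := contr z (Z j) _ cz (cZ j) zj t tab.
  have -> : T (Z j) t = Z j.+1 t by rewrite /Z/= r_id.
  have := zE j.+1 t; rewrite enormBC exprS => h1 h2.
  have /andP[q0 q1] := q_lt1.
  have qj : 0 <= q ^+ j by rewrite exprn_ge0.
  have qD : q * (D * q ^+ j) <= D * q ^+ j.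
    by rewrite ler_piMl// ?mulr_ge0// ltW.
  have qDW : q * (D * q ^+ j) * W t <= D * q ^+ j * W t.
    by rewrite ler_wpM2r// expR_ge0.
  lra.
(* The solution returned is [T z]: it equals [z] on [[a, b]], but has two-sided derivatives at the
   end points by construction. *)
have [Tc Td] := TE z cz; exists (T z); split=> // t tab.
by rewrite !Tz//; exact: Td.
Qed.

End LocalProblem.

(** * Locating a time among the switching points *)

Section SwitchingSequence.
Context {R : realType} (tau : int -> R) (theta : R).
Context (Htau : switching_sequence tau theta).

Lemma tau_lt i j : i < j -> tau i < tau j.
Proof. by case: Htau => + _ _; apply. Qed.

Lemma tau_le i j : i <= j -> tau i <= tau j.
Proof. by rewrite le_eqVlt => /predU1P[->//|/tau_lt/ltW]. Qed.

Lemma tau_ltS i : tau i < tau (i + 1).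
Proof. by apply: tau_lt; lia. Qed.

Lemma tau_index_le i j t : tau i <= t -> t < tau (j + 1) -> i <= j.
Proof.
move=> it tj; rewrite leNgt; apply/negP => ji.
have : tau (j + 1) <= tau i by apply: tau_le; lia.
by move=> /(lt_le_trans tj); rewrite ltNge it.
Qed.

Lemma tau_index_uniq i j t :
  tau i <= t < tau (i + 1) -> tau j <= t < tau (j + 1) -> i = j.
Proof.
move=> /andP[it ti] /andP[jt tj]; apply/eqP.
by rewrite eq_le (tau_index_le _ _ _ it tj) (tau_index_le _ _ _ jt ti).
Qed.

Lemma tau_index t : exists i, tau i <= t < tau (i + 1).
Proof.
case: Htau => _ /(_ (`|tau 0| + `|t| + 1))[N NP] _.
(* Beyond the threshold [N], [|tau m|] and [|tau (- m)|] are at least [|tau 0| + |t| + 1];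
   comparison with [tau 0] fixes their signs, whence [tau (- m) <= t < tau m]. *)
pose m : int := `|N| + 1.
have Nm : N <= `|m| by rewrite /m; lia.
have Nm' : N <= `|- m| by rewrite normrN.
have m0 : 0 < m by rewrite /m; lia.
have up : t < tau m.
  have := NP _ Nm; have := tau_lt _ _ m0; have := ler_norm t.
  have := ler_norm (- tau 0); rewrite normrN; have := normr_ge0 t.
  have := normr_ge0 (tau 0); case: (ger0P (tau m)) => *; lra.
have low : tau (- m) <= t.
  have mN0 : - m < 0 by lia.
  have := NP _ Nm'; have := tau_lt _ _ mN0; have := ler_norm (- t).
  have := ler_norm (tau 0); rewrite normrN; have := normr_ge0 t.
  have := normr_ge0 (tau 0); case: (ger0P (tau (- m))) => *; lra.
have ex : exists j : nat, t < tau (- m + j%:Z).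
  by exists (absz (m + m)); have -> : - m + (absz (m + m))%:Z = m by lia.
(* The required index is one before the least [j] with [t < tau (- m + j)]; [low] excludes
   [j = 0]. *)
case: (ex_minnP ex) => -[|j] tj jmin; first by move: tj;
  rewrite addr0 ltNge low.
exists (- m + j%:Z); apply/andP; split.
  by rewrite leNgt; apply/negP => /jmin; rewrite ltnn.
by rewrite -addrA -natz -(natrD _ j 1) natz addn1.
Qed.

End SwitchingSequence.

(** * Gluing local solutions across switching points *)

Section Gluing.
Context {R : realType} {n : nat} (tau : int -> R) (theta : R).
Context (Htau : switching_sequence tau theta).
Context (g : R -> 'cV[R]_n -> 'cV[R]_n -> 'cV[R]_n).
Implicit Types z y : R -> 'cV[R]_n.

Definition smooth_piece (k : int) y := forall t, t \in `[tau k, tau (k + 1)] ->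
  is_derive t 1 y (g t (y t) (y (tau k))).

(* Stable under gluing, and gives the one-sided derivatives at the end points,
   where [z] itself need not be differentiable. *)
Definition piecewise_smooth (i : int) z := forall k, i <= k ->
  exists2 y, smooth_piece k y &
    forall t, t \in `[tau k, tau (k + 1)] -> z t = y t.

(** This weaker form asks for no derivative at the switching points, so any solution provides it.
    Uniqueness is proved here, existence for [piecewise_smooth]. *)
Definition piecewise_solution (i : int) z := forall k, i <= k ->
  {within `[tau k, tau (k + 1)], continuous z} /\
  forall t, t \in `]tau k, tau (k + 1)[ ->
    is_derive t 1 z (g t (z t) (z (tau k))).

Lemma left_mem k : tau k \in `[tau k, tau (k + 1)].
Proof. by rewrite in_itv/= lexx ltW// (tau_ltS _ _ Htau). Qed.

Lemma right_mem k : tau (k + 1) \in `[tau k, tau (k + 1)].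
Proof. by rewrite in_itv/= lexx ltW// (tau_ltS _ _ Htau). Qed.

Context (exist : forall k c x0, c \in `[tau k, tau (k + 1)] ->
  exists2 y, smooth_piece k y & y c = x0).

Lemma glue i y z : smooth_piece i y -> piecewise_smooth (i + 1) z ->
  y (tau (i + 1)) = z (tau (i + 1)) ->
  exists z', [/\ piecewise_smooth i z',
    forall t, t <= tau (i + 1) -> z' t = y t &
    forall t, tau (i + 1) <= t -> z' t = z t].
Proof.
move=> yi zi yz; exists (fun t => if t <= tau (i + 1) then y t else z t).
have zE t : tau (i + 1) <= t -> (if t <= tau (i + 1) then y t else z t) = z t.
  by case: ifPn => // ti it; rewrite (@le_anti _ _ t (tau (i + 1))) ?ti ?it.
split=> [k ik| t ->//|//].
have [<-|nik] := eqVneq i k.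
  by exists y => // t; rewrite in_itv/= => /andP[_ ->].
have ik1 : i + 1 <= k by lia.
have [y' y'k zy'] := zi k ik1; exists y' => // t tk; rewrite zE ?zy'//.
by move: tk; rewrite in_itv/= => /andP[+ _]; apply/le_trans/(tau_le _ _ Htau).
Qed.

(** Local solutions are chained: [S (k, w)] starts from [w] at [tau k], [v m] is the value reached
    at [tau (i + m)], and [z] follows the piece of the interval containing [t]. *)
Lemma forward_existence i w :
  exists2 z, piecewise_smooth i z & z (tau i) = w.
Proof.
have /choice[S SE] (kw : int * 'cV[R]_n) : exists y,
    smooth_piece kw.1 y /\ y (tau kw.1) = kw.2.
  by have [y] := exist kw.1 (tau kw.1) kw.2 (left_mem _); exists y.
have /choice[idx idxE] := tau_index _ _ Htau.
pose v := fix v (m : nat) : 'cV[R]_n :=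
  if m is m'.+1 then S (i + m'%:Z, v m') (tau (i + m'%:Z + 1)) else w.
(* For [t < tau i] the absolute value selects an unrelated piece, which is harmless. *)
pose z t := S (idx t, v `|idx t - i|%N) t.
have zE (m : nat) t : tau (i + m%:Z) <= t < tau (i + m%:Z + 1) ->
    z t = S (i + m%:Z, v m) t.
  move=> it; rewrite /z (tau_index_uniq _ _ Htau _ _ t (idxE t) it).
  by rewrite addrC addKr absz_nat.
have zv (m : nat) : z (tau (i + m%:Z)) = v m.
  by rewrite (zE m) ?lexx ?(tau_ltS _ _ Htau)//; have [] := SE (i + m%:Z, v m).
exists z => [k ik|]; last by have := zv 0%N; rewrite addr0.
have [m ->] : exists m : nat, k = i + m%:Z by exists `|k - i|%N; lia.
exists (S (i + m%:Z, v m)); first by have [] := SE (i + m%:Z, v m).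
move=> t; rewrite in_itv/= => /andP[it].
rewrite le_eqVlt => /predU1P[->|ti]; last by rewrite (zE m)// it.
(* At the right end point [z] already follows the next piece, whose initial value [v m.+1] is by
   definition the final value of the current one. *)
have mE : i + m%:Z + 1 = i + m.+1%:Z by lia.
by rewrite mE zv/= -mE.
Qed.

(** Induction on the number [d] of intervals to cross. The interval of [t0] is solved through the
    given point and extended forward; each further interval is solved from its right end point. *)
Lemma backward_existence (d : nat) i t0 x0 :
  t0 \in `[tau (i + d%:Z), tau (i + d%:Z + 1)] ->
  exists2 z, piecewise_smooth i z & z t0 = x0.
Proof.
elim: d i => [|d IH] i.
  rewrite addr0 => t0i; have [y yi yt0] := exist _ _ x0 t0i.
  have [z zi zy] := forward_existence (i + 1) (y (tau (i + 1))).
  have [z' [z'i z'y _]] := glue _ _ _ yi zi (esym zy).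
  by exists z' => //; rewrite z'y//; move: t0i; rewrite in_itv/= => /andP[].
rewrite -addn1 PoszD (addrC d%:Z) addrA => t0i.
have [z zi zt0] := IH (i + 1) t0i.
have [y yi yz] := exist i _ (z (tau (i + 1))) (right_mem i).
have [z' [z'i _ z'z]] := glue _ _ _ yi zi yz.
exists z' => //; rewrite z'z//.
move: t0i; rewrite in_itv/= => /andP[+ _].
by apply/le_trans/(tau_le _ _ Htau); lia.
Qed.

Context (uniq : forall k c y1 y2, c \in `[tau k, tau (k + 1)] ->
  {within `[tau k, tau (k + 1)], continuous y1} ->
  {within `[tau k, tau (k + 1)], continuous y2} ->
  y1 c = y2 c ->
  (forall t, t \in `]tau k, tau (k + 1)[ ->
    is_derive t 1 y1 (g t (y1 t) (y1 (tau k)))) ->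
  (forall t, t \in `]tau k, tau (k + 1)[ ->
    is_derive t 1 y2 (g t (y2 t) (y2 (tau k)))) ->
  forall t, t \in `[tau k, tau (k + 1)] -> y1 t = y2 t).

(** Agreement at one point of an interval spreads over the whole interval. It descends through the
    switching points from [tau p] to [tau i], then ascends from [tau i] to any later time. *)
Lemma piecewise_uniqueness i p t0 z1 z2 : i <= p ->
  piecewise_solution i z1 -> piecewise_solution i z2 ->
  t0 \in `[tau p, tau (p + 1)] -> z1 t0 = z2 t0 ->
  forall t, tau i <= t -> z1 t = z2 t.
Proof.
move=> ip z1i z2i t0p z12.
have local k c : i <= k -> c \in `[tau k, tau (k + 1)] -> z1 c = z2 c ->
    forall t, t \in `[tau k, tau (k + 1)] -> z1 t = z2 t.
  move=> ik ck z12c; have [c1 d1] := z1i k ik; have [c2 d2] := z2i k ik.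
  exact: (uniq k c).
have tau_p := local _ _ ip t0p z12 _ (left_mem p).
have down (d : nat) : i <= p - d%:Z -> z1 (tau (p - d%:Z)) = z2 (tau (p -
  d%:Z)).
  elim: d => [_|d IH ipd]; first by rewrite subr0.
  have pE : p - d%:Z = p - d.+1%:Z + 1 by lia.
  have ipd' : i <= p - d%:Z by lia.
  apply: (local _ _ ipd (right_mem _)); last exact: left_mem.
  by rewrite -pE IH.
have at_i : z1 (tau i) = z2 (tau i).
  have iE : p - `|p - i|%N%:Z = i by lia.
  by have := down `|p - i|%N; rewrite iE => ->.
have at_tau (m : nat) : z1 (tau (i + m%:Z)) = z2 (tau (i + m%:Z)).
  elim: m => [|m IH]; first by rewrite addr0.
  have mE : i + m.+1%:Z = i + m%:Z + 1 by lia.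
  rewrite mE; apply: (local (i + m%:Z) (tau (i + m%:Z)));
    [lia|exact: left_mem|by []|].
  exact: right_mem.
move=> t it; have [k /andP[kt tk]] := tau_index _ _ Htau t.
have ik : i <= k := tau_index_le _ _ Htau _ _ _ it tk.
apply: (local k (tau k) ik (left_mem k)); last by rewrite in_itv/= kt ltW.
have kE : k = i + (absz (k - i))%:Z by lia.
by rewrite kE; exact: at_tau.
Qed.

End Gluing.

(** * Passing between piecewise functions and solutions of the equation *)

Section Solutions.
Context {R : realType} {n : nat} (tau : int -> R) (theta : R) (beta : R -> R).
Context (Htau : switching_sequence tau theta)
  (Hbeta : switching_argument tau beta).
Context (A : R -> 'M[R]_n) (f : R -> 'cV[R]_n -> 'cV[R]_n -> 'cV[R]_n).

Let g (t : R) (y w : 'cV[R]_n) : 'cV[R]_n := A t *m y + f t y w.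

Lemma is_derive_continuous (y : R -> 'cV[R]_n) (t : R) (v : 'cV[R]_n) :
  is_derive t 1 y v -> {for t, continuous y}.
Proof. by case=> dy _; exact/differentiable_continuous/derivable1_diffP. Qed.

Lemma is_derive_right_derivative (y : R -> 'cV[R]_n) (t : R) (v : 'cV[R]_n) :
  is_derive t 1 y v -> right_derivative y t v.
Proof.
case=> /cvg_ex[l yl] <-; apply: cvg_dnbhs_at_right.
rewrite /derive (cvg_lim _ yl)//; apply: cvg_trans yl.
by apply: near_eq_cvg; apply: nearW => h; rewrite /= [h *: 1]mulr1 [t + h]addrC.
Qed.

Lemma piecewise_smooth_cvg_right i z t : piecewise_smooth tau g i z ->
  tau i <= t -> z @ t^'+ --> z t.
Proof.
move=> zi it; have [k /andP[kt tk]] := tau_index _ _ Htau t.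
have [y yk zy] := zi k (tau_index_le _ _ Htau _ _ _ it tk).
have tk' : t \in `[tau k, tau (k + 1)] by rewrite in_itv/= kt ltW.
have yt : y @ t^'+ --> y t.
  exact/cvg_at_right_filter/(is_derive_continuous _ _ _ (yk t tk')).
rewrite zy//; apply: cvg_trans yt; apply: near_eq_cvg.
have := nbhs_right_lt tk; have := nbhs_right_ge t => ge lt.
apply: filterS (filterI ge lt) => s [ts sk]; rewrite zy//.
by rewrite in_itv/= (le_trans kt ts) ltW.
Qed.

Lemma piecewise_smooth_cvg_left i z t : piecewise_smooth tau g i z ->
  tau i < t -> z @ t^'- --> z t.
Proof.
move=> zi it.
have [k [ik kt tk]] : exists k, [/\ i <= k, tau k < t & t <= tau (k + 1)].
  have [k /andP[+ tk]] := tau_index _ _ Htau t.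
  have ik : i <= k := tau_index_le _ _ Htau _ _ _ (ltW it) tk.
  rewrite le_eqVlt => /predU1P[kt|kt]; last by exists k; rewrite ik kt ltW.
  (* A switching point [tau k] is approached from the left inside interval [k - 1], and [i <= k - 1]
     because [tau i < t]. *)
  have kE : k = k - 1 + 1 by rewrite subrK.
  exists (k - 1); rewrite -kE kt lexx; split=> //.
    have : i != k by apply: contraTneq it => ->; rewrite kt ltxx.
    by lia.
  by rewrite -kt (tau_lt _ _ Htau)//; lia.
have [y yk zy] := zi k ik.
have tk' : t \in `[tau k, tau (k + 1)] by rewrite in_itv/= tk ltW.
have yt : y @ t^'- --> y t.
  exact/cvg_at_left_filter/(is_derive_continuous _ _ _ (yk t tk')).
rewrite zy//; apply: cvg_trans yt; apply: near_eq_cvg.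
have := nbhs_left_gt kt; have := nbhs_left_le t => le gt.
apply: filterS (filterI le gt) => s [st ks]; rewrite zy//.
by rewrite in_itv/= (le_trans st tk) ltW.
Qed.

(** At interior points [z] equals a piece [y] nearby and inherits its derivative; at [tau j]
    equality is guaranteed only to the right, which yields the right derivative. *)
Lemma piecewise_smooth_solution i z a : piecewise_smooth tau g i z ->
  tau i <= a < tau (i + 1) -> solution A f tau beta a (z a) z.
Proof.
move=> zi ia; exists i; split=> //.
- apply/continuous_within_itvcyP; split; last exact: piecewise_smooth_cvg_right
  zi _.
  move=> t; rewrite in_itv/= andbT => it; apply/left_right_continuousP; split.
    exact: piecewise_smooth_cvg_left zi it.
  exact: piecewise_smooth_cvg_right zi (ltW it).
- move=> j t ij /andP[jt tj]; have [y yj zy] := zi j ij.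
  have tj' : t \in `[tau j, tau (j + 1)] by rewrite in_itv/= !ltW.
  rewrite (Hbeta j t (ltW jt) tj) !zy ?(left_mem _ _ Htau)//.
  apply: near_eq_is_derive (yj t tj').
  have tjo : t \in `]tau j, tau (j + 1)[ by rewrite in_itv/= jt.
  apply: filterS (near_in_itvoo tjo) => s sj.
  by rewrite zy//; exact: subset_itv_oo_cc sj.
- move=> j ij; have [y yj zy] := zi j ij.
  have jj := left_mem _ _ Htau j; have jlt := tau_ltS _ _ Htau j.
  rewrite (Hbeta j _ (lexx _) jlt) !zy//.
  have := is_derive_right_derivative _ _ _ (yj _ jj).
  apply: cvg_trans; apply: near_eq_cvg.
  have d0 : 0 < tau (j + 1) - tau j by rewrite subr_gt0.
  have := nbhs_right_lt d0; have := nbhs_right_ge (0 : R) => ge lt.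
  apply: filterS (filterI ge lt) => h [h0 hd]; rewrite !zy//.
  by rewrite in_itv/= lerDl h0/= -lerBrDl ltW.
Qed.

Lemma solution_piecewise i x :
  {within `[tau i, +oo[, continuous x} ->
  (forall (j : int) (t : R), i <= j -> tau j < t < tau (j + 1) ->
     is_derive t 1 x (A t *m x t + f t (x t) (x (beta t)))) ->
  piecewise_solution tau g i x.
Proof.
move=> cx dx k ik; split.
  apply: continuous_subspaceW cx => t /=; rewrite !in_itv/= andbT => /andP[+ _].
  exact/le_trans/(tau_le _ _ Htau).
move=> t; rewrite in_itv/= => /andP[kt tk].
by have := dx k t ik; rewrite kt tk (Hbeta k t (ltW kt) tk); exact.
Qed.

End Solutions.

(** * Continuity of the linear term and assembly of the proof *)

Lemma continuous_mulmx_col {R : realType} {n : nat} (A : R -> 'M[R]_n)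
    (y : 'cV[R]_n) :
  continuous A -> continuous (fun t => A t *m y).
Proof.
move=> cA t; apply/cvg_enormP => e e0.
(* [C = n^2 |y|] bounds [|B y|] when the entries of [B] are at most 1 in absolute value; [C + 1]
   avoids division by zero. *)
pose C := \sum_(i < n) \sum_(j < n) enorm y.
have C0 : 0 <= C by apply: sumr_ge0 => i _; apply: sumr_ge0 => j _;
  exact: enorm_ge0.
have e1 : 0 < e / (C + 1) by rewrite divr_gt0// ltr_pwDr.
have /cvgrPdist_le/(_ _ e1) := cA t; apply: filterS => s ts.
rewrite -mulmxBl; apply: (le_trans (enorm_mulmx_le _ _)).
apply: (@le_trans _ _ (C * (e / (C + 1)))); last first.
  rewrite mulrCA -[leRHS]mulr1; apply: ler_wpM2l; first exact: ltW.
  by rewrite ler_pdivrMr ?ltr_pwDr// mul1r lerDl.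
rewrite mulr_suml mulr_suml; apply: ler_sum => i _.
rewrite mulr_suml mulr_suml; apply: ler_sum => j _.
rewrite mulrC ler_wpM2l ?enorm_ge0//; apply: le_trans ts.
rewrite [leRHS]/Num.Def.normr/= mx_normrE.
exact: (le_bigmax _ (fun ij => `|(A t - A s) ij.1 ij.2|) (i, j)).
Qed.

Theorem theorem1p1 (R : realType) (n : nat)
    (tau : int -> R) (theta : R) (beta : R -> R)
    (theta_gt0 : 0 < theta)
    (Htau : switching_sequence tau theta)
    (Hbeta : switching_argument tau beta)
    (A : R -> 'M[R]_n) (mu : R)
    (A_cont : continuous A)
    (A_sup : ereal_sup [set (opnorm (A t))%:E | t in [set: R]] = mu%:E)
    (f : R -> 'cV[R]_n -> 'cV[R]_n -> 'cV[R]_n) (l : R)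
    (f_cont : forall y w : 'cV[R]_n, continuous (fun t : R => f t y w))
    (f_zero : forall t : R, f t 0 0 = 0)
    (f_lip : forall (t : R) (y1 y2 w1 w2 : 'cV[R]_n),
       enorm (f t y1 w1 - f t y2 w2) <= l * (enorm (y1 - y2) + enorm (w1 - w2)))
    (K sigma : R) (K_gt0 : 0 < K) (sigma_gt0 : 0 < sigma)
    (A_dich : exponential_dichotomy A K sigma)
    (smallness :
       let M := expR (mu * theta) in
       let m := expR (- (mu * theta)) in
       l * M * theta * (1 + M * (1 + l * theta) * expR (M * l * theta)) < m) :
  forall (t0 : R) (x0 : 'cV[R]_n) (x : R -> 'cV[R]_n),
    solution A f tau beta t0 x0 x ->
    forall a : R, a < t0 -> uniquely_backward_continued A f tau beta t0 x0 a.
Proof.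
move=> t0 x0 _ _ a at0.
have opA t : opnorm (A t) <= mu.
  by rewrite -lee_fin -A_sup; apply: ereal_sup_ubound; exists t.
have mu0 : 0 <= mu by exact: le_trans (opnorm_ge0 (A 0)) (opA 0).
(* A negative Lipschitz constant, possible only if [n = 0], is replaced by 0. *)
have [L [L0 L_lip L_small]] : exists L, [/\ 0 <= L,
    forall t (y1 y2 w1 w2 : 'cV[R]_n), enorm (f t y1 w1 - f t y2 w2) <=
      L * (enorm (y1 - y2) + enorm (w1 - w2)) &
    2 * L * expR (mu * theta) * theta < expR (- (mu * theta))].
  have [l0|l0] := leP 0 l; last first.
    exists 0; split=> [//|t y1 y2 w1 w2|]; last by rewrite mulr0 !mul0r
      expR_gt0.
    apply: (le_trans (f_lip _ _ _ _ _)); rewrite mul0r.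
    by rewrite nmulr_rle0// addr_ge0// enorm_ge0.
  exists l; split=> //; apply: le_lt_trans smallness.
  set M := expR (mu * theta).
  have M1 : 1 <= M by rewrite -expR0 ler_expR mulr_ge0// ltW.
  have lt0' : 0 <= l * theta by rewrite mulr_ge0// ltW.
  have B1 : 1 <= M * (1 + l * theta) * expR (M * l * theta).
    rewrite -[leLHS]mulr1 ler_pM//.
      by rewrite -[leLHS]mulr1 ler_pM// lerDl.
    by rewrite -expR0 ler_expR -mulrA mulr_ge0// expR_ge0.
  rewrite [leLHS](_ : _ = l * M * theta * 2); last by ring.
  apply: ler_wpM2l; first by rewrite !mulr_ge0// ?expR_ge0// ltW.
  by rewrite [leLHS](_ : _ = 1 + 1)// lerD2l.
pose g (t : R) (y w : 'cV[R]_n) : 'cV[R]_n := A t *m y + f t y w.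
have g_cont y w : continuous (fun t => g t y w).
  by move=> t; apply: cvgD; [exact: continuous_mulmx_col|exact: f_cont].
have g_lip t y1 y2 w1 w2 : enorm (g t y1 w1 - g t y2 w2) <=
    (mu + L) * enorm (y1 - y2) + L * enorm (w1 - w2).
  rewrite /g opprD addrACA -mulmxBr; apply: (le_trans (enormD _ _)).
  have h1 := L_lip t y1 y2 w1 w2.
  have h2 : enorm (A t *m (y1 - y2)) <= mu * enorm (y1 - y2).
    by apply: (le_trans (enorm_mulmx _ _)); rewrite ler_wpM2r ?enorm_ge0.
  lra.
have len k : tau (k + 1) - tau k <= theta by case: Htau.
have exist k c w : c \in `[tau k, tau (k + 1)] ->
    exists2 y, smooth_piece tau g k y & y c = w.
  move=> ck; have [y [yc dy]] := local_existence g mu L theta mu0 L0 (ltW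
    theta_gt0)
    g_cont g_lip L_small (tau k) (tau (k + 1)) c ck (len k) w.
  by exists y.
have uniq k c y1 y2 ck := local_uniqueness g mu L theta mu0 L0 (ltW theta_gt0)
  g_lip L_small (tau k) (tau (k + 1)) c ck (len k) y1 y2.
(* A solution started at [a] lives on the half-line from [tau i], so the continuation through
   [(t0, x0)] is built back to [tau i] and its value at [a] is read off. *)
have [i ia] := tau_index _ _ Htau a; have [p pt] := tau_index _ _ Htau t0.
have /andP[ia1 ia2] := ia; have /andP[pt1 pt2] := pt.
have ip : i <= p := tau_index_le _ _ Htau _ _ _ (le_trans ia1 (ltW at0)) pt2.
have pE : p = i + (absz (p - i))%:Z by lia.
have t0p : t0 \in `[tau p, tau (p + 1)] by rewrite in_itv/= pt1 ltW.
have [z zi zt0] : exists2 z, piecewise_smooth tau g i z & z t0 = x0.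
  by apply: (backward_existence tau theta Htau g exist (absz (p - i)));
    rewrite -pE.
have z_sol := piecewise_smooth_solution tau theta beta Htau Hbeta A f i z a zi
  ia.
exists (z a), z; split=> // xbar z' [[i' [i'a z'a cz' dz' _]] z't0].
(* The index hidden in each solution is determined by [a], so [z] and [z'] share the half-line from
   [tau i] and are compared through their common value at [t0]. *)
have i'E := tau_index_uniq _ _ Htau _ _ _ i'a ia;
  rewrite {i'}i'E in i'a cz' dz' *.
have [i'' [i''a _ cz dz _]] := z_sol.
have i''E := tau_index_uniq _ _ Htau _ _ _ i''a ia;
  rewrite {i''}i''E in i''a cz dz *.
have zz' t : tau i <= t -> z' t = z t.
  apply: (piecewise_uniqueness tau theta Htau g uniq i p t0) => //.
  - exact: (solution_piecewise tau theta beta Htau Hbeta A f).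
  - exact: (solution_piecewise tau theta beta Htau Hbeta A f).
  - by rewrite zt0.
by rewrite (Hbeta i a ia1 ia2) -z'a zz'.
Qed.
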